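(* Let $\Bbbk$ be a field and let $L$ be a post-Lie algebra over $\Bbbk$. Then $L$ injectively embeds into its universal enveloping postassociative algebra; that is, if $U(L)$ denotes the universal enveloping postassociative algebra of $L$ with canonical homomorphism of post-Lie algebras $\iota\colon L\to U(L)^{(-)}$, then $\iota$ is injective.
   Context: All algebras are over a field $\Bbbk$. A post-Lie algebra is a vector space with two bilinear operations $[\cdot,\cdot]$ and $\cdot$ such that $[\cdot,\cdot]$ is a Lie bracket and, for all $x,y,z$, $$(x\cdot y)\cdot z-x\cdot(y\cdot z)-(y\cdot x)\cdot z+y\cdot(x\cdot z)=[y,x]\cdot z,\qquad x\cdot[y,z]=[x\cdot y,z]+[y,x\cdot z].$$ A postassociative algebra is a vector space with three bilinear operations $\cdot,\succ,\prec$ satisfying, for all $x,y,z$, the seven identities $$(x\prec y)\prec z=x\prec(y\succ z+y\prec z+y\cdot z),\quad (x\succ y)\prec z=x\succ(y\prec z),$$ $$(x\succ y+x\prec y+x\cdot y)\succ z=x\succ(y\succ z),$$ $$x\succ(y\cdot z)=(x\succ y)\cdot z,\quad (x\prec y)\cdot z=x\cdot(y\succ z),$$ $$(x\cdot y)\prec z=x\cdot(y\prec z),\quad (x\cdot y)\cdot z=x\cdot(y\cdot z).$$ If $(B,\cdot,\succ,\prec)$ is a postassociative algebra, then $B^{(-)}$ denotes the post-Lie algebra on the same vector space with bracket $[x,y]=x\cdot y-y\cdot x$ and post-Lie product $(x,y)\mapsto x\succ y-y\prec x$ (the latter playing the role of the operation $\cdot$ of a post-Lie algebra). The universal enveloping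 postassociative algebra of a post-Lie algebra $L$ is a postassociative algebra $U(L)$ together with a homomorphism of post-Lie algebras $\iota\colon L\to U(L)^{(-)}$ such that for every postassociative algebra $B$ and every homomorphism of post-Lie algebras $\varphi\colon L\to B^{(-)}$ there is a unique homomorphism of postassociative algebras $\psi\colon U(L)\to B$ with $\psi\circ\iota=\varphi$. *)

(* Defs.v *)
From HB Require Import structures.
From mathcomp Require Import all_boot all_order all_algebra.

Set Implicit Arguments.
Unset Strict Implicit.
Unset Printing Implicit Defensive.

Import GRing.Theory.
Local Open Scope ring_scope.

(* lie x y is [x, y] and plmul x y is the post-Lie product x . y.
   The characteristic of k is arbitrary, so the Lie bracket is required to be
   alternating and not merely antisymmetric. *)
HB.mixin Record Lmodule_isPostLie (k : fieldType) L of GRing.Lmodule k L := {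
  lie : L -> L -> L;
  plmul : L -> L -> L;
  lie_bilinear : bilinear_for *:%R *:%R lie;
  plmul_bilinear : bilinear_for *:%R *:%R plmul;
  lie_alternating : forall x, lie x x = 0;
  lie_jacobi : forall x y z,
    lie x (lie y z) + lie y (lie z x) + lie z (lie x y) = 0;
  plmul_assoc_lie : forall x y z,
    plmul (plmul x y) z - plmul x (plmul y z)
      - plmul (plmul y x) z + plmul y (plmul x z) = plmul (lie y x) z;
  plmul_lie : forall x y z,
    plmul x (lie y z) = lie (plmul x y) z + lie y (plmul x z)
}.

#[short(type="postLieType")]
HB.structure Definition PostLie (k : fieldType) :=
  {L of Lmodule_isPostLie k L & GRing.Lmodule k L}.

HB.instance Definition _ (k : fieldType) (L : postLieType k) :=
  bilinear_isBilinear.Build k L L L *:%R *:%R (@lie k L) lie_bilinear.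
HB.instance Definition _ (k : fieldType) (L : postLieType k) :=
  bilinear_isBilinear.Build k L L L *:%R *:%R (@plmul k L) plmul_bilinear.


(* pamul x y, pasucc x y and paprec x y are the three products x . y,
   x \succ y and x \prec y respectively. *)
HB.mixin Record Lmodule_isPostAss (k : fieldType) B of GRing.Lmodule k B := {
  pamul : B -> B -> B;
  pasucc : B -> B -> B;
  paprec : B -> B -> B;
  pamul_bilinear : bilinear_for *:%R *:%R pamul;
  pasucc_bilinear : bilinear_for *:%R *:%R pasucc;
  paprec_bilinear : bilinear_for *:%R *:%R paprec;
  paprecA : forall x y z, paprec (paprec x y) z =
    paprec x (pasucc y z + paprec y z + pamul y z);
  pasucc_precA : forall x y z,
    paprec (pasucc x y) z = pasucc x (paprec y z);
  pasuccA : forall x y z,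
    pasucc (pasucc x y + paprec x y + pamul x y) z = pasucc x (pasucc y z);
  pasucc_mulA : forall x y z, pasucc x (pamul y z) = pamul (pasucc x y) z;
  paprec_mul_succ : forall x y z, pamul (paprec x y) z = pamul x (pasucc y z);
  pamul_precA : forall x y z, paprec (pamul x y) z = pamul x (paprec y z);
  pamulA : forall x y z, pamul (pamul x y) z = pamul x (pamul y z)
}.

#[short(type="postAssType")]
HB.structure Definition PostAss (k : fieldType) :=
  {B of Lmodule_isPostAss k B & GRing.Lmodule k B}.

HB.instance Definition _ (k : fieldType) (B : postAssType k) :=
  bilinear_isBilinear.Build k B B B *:%R *:%R (@pamul k B) pamul_bilinear.
HB.instance Definition _ (k : fieldType) (B : postAssType k) :=
  bilinear_isBilinear.Build k B B B *:%R *:%R (@pasucc k B) pasucc_bilinear.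
HB.instance Definition _ (k : fieldType) (B : postAssType k) :=
  bilinear_isBilinear.Build k B B B *:%R *:%R (@paprec k B) paprec_bilinear.

(* B^(-) is an alias of B, so that the same carrier can bear a post-Lie
   structure; it keeps the k-module structure of B. *)
Definition postass_minus (k : fieldType) (B : postAssType k) : Type := B.
Notation "B ^(-)" := (postass_minus B) (at level 2, format "B ^(-)").

Section PostAssMinus.
Variables (k : fieldType) (B : postAssType k).
Implicit Types x y z : B.

Definition minus_lie x y : B := pamul x y - pamul y x.
Definition minus_plmul x y : B := pasucc x y - paprec y x.

Let bilin_sub_flip (f g : {bilinear B -> B -> B}) :
  bilinear_for *:%R *:%R (fun x y => f x y - g y x).
Proof.
split=> u a x y /=; rewrite !(linearPl, linearPr) /= scalerBr;
by rewrite opprD addrACA.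
Qed.

Let zmod_cancel (V : zmodType) (a b : V) : a - b = 0 -> a = b.
Proof. by move/eqP; rewrite subr_eq0 => /eqP. Qed.

Local Ltac cancel :=
  apply: zmod_cancel; rewrite ?subr0 ?(opprD, opprK) -[LHS]addr0 -!addrA;
  repeat match goal with
  | |- - ?a + _ = 0 => rewrite !(addrCA _ a) addNKr
  | |- ?a + _ = 0 => rewrite !(addrCA _ (- a)) addKr
  end.

Local Ltac expand :=
  rewrite !(linearBl, linearBr, linearDl, linearDr, opprD, opprK) /=.

Fact minus_lie_bilinear : bilinear_for *:%R *:%R minus_lie.
Proof. exact: (bilin_sub_flip (@pamul k B) (@pamul k B)). Qed.

Fact minus_plmul_bilinear : bilinear_for *:%R *:%R minus_plmul.
Proof. exact: (bilin_sub_flip (@pasucc k B) (@paprec k B)). Qed.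

Fact minus_lie_alternating x : minus_lie x x = 0.
Proof. exact: subrr. Qed.

Fact minus_lie_jacobi x y z :
  minus_lie x (minus_lie y z) + minus_lie y (minus_lie z x)
    + minus_lie z (minus_lie x y) = 0.
Proof. by rewrite /minus_lie; expand; rewrite !pamulA; cancel. Qed.

Fact minus_plmul_assoc_lie x y z :
  minus_plmul (minus_plmul x y) z - minus_plmul x (minus_plmul y z)
    - minus_plmul (minus_plmul y x) z + minus_plmul y (minus_plmul x z)
  = minus_plmul (minus_lie y x) z.
Proof.
rewrite /minus_plmul /minus_lie; expand.
by rewrite -!pasuccA !paprecA !pasucc_precA; expand; cancel.
Qed.

Fact minus_plmul_lie x y z :
  minus_plmul x (minus_lie y z)
  = minus_lie (minus_plmul x y) z + minus_lie y (minus_plmul x z).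
Proof.
rewrite /minus_plmul /minus_lie; expand.
by rewrite !pasucc_mulA !paprec_mul_succ !pamul_precA; cancel.
Qed.

HB.instance Definition _ := GRing.Lmodule.on B^(-).
HB.instance Definition _ := Lmodule_isPostLie.Build k B^(-)
  minus_lie_bilinear minus_plmul_bilinear minus_lie_alternating
  minus_lie_jacobi minus_plmul_assoc_lie minus_plmul_lie.
End PostAssMinus.

Definition postlie_hom (k : fieldType) (L M : postLieType k)
    (f : {linear L -> M}) : Prop :=
  {morph f : x y / lie x y} /\ {morph f : x y / plmul x y}.

Definition postass_hom (k : fieldType) (A B : postAssType k)
    (f : {linear A -> B}) : Prop :=
  [/\ {morph f : x y / pamul x y}, {morph f : x y / pasucc x y}
    & {morph f : x y / paprec x y}].

(* The algebras B range over the same (fixed) universe of k-modules as L and U.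
   The equation psi (iota x) = phi x identifies U^(-) with U and B^(-) with B
   as types. *)
Definition is_universal_enveloping (k : fieldType) (L : postLieType k)
    (U : postAssType k) (iota : {linear L -> U^(-)}) : Prop :=
  postlie_hom iota /\
  forall (B : postAssType k) (phi : {linear L -> B^(-)}), postlie_hom phi ->
    exists psi : {linear U -> B},
      [/\ postass_hom psi, forall x, psi (iota x) = phi x
        & forall psi' : {linear U -> B}, postass_hom psi' ->
            (forall x, psi' (iota x) = phi x) -> psi' =1 psi].

(* Main.v *)
Require Import Defs.
From HB Require Import structures.
From mathcomp Require Import all_boot all_order all_algebra.
From mathcomp Require Import boolp functions wochoice ring.
Import GRing.Theory.
Local Open Scope ring_scope.

Set Implicit Arguments.
Unset Strict Implicit.
Unset Printing Implicit Defensive.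

(* By the universal property it is enough to embed L into some B^(-).
   Put {x, y} = x . y - y . x + [x, y]; this is a Lie bracket, for which L acts
   on itself by z |-> x . z.  Let V be the space of linear functionals on the
   enveloping algebra of (L, {,}), and let B = End V.  The operators commuting
   with all translations f |-> f (_ v) form a subalgebra of B which is
   complementary to the subalgebra of those F such that F f vanishes at the
   empty word for every f.  Minus the projection onto the former along the
   latter is therefore a Rota-Baxter operator R of weight 1, and
   F \succ G = R(F) G, F \prec G = F R(G), F . G = F G make B postassociative.
   The map i : L -> B is forced by (i y f)(empty word) = f(y) and
   [R(i x), i y] = i(x . y); it is a homomorphism to B^(-), and it is injective
   as soon as functionals in V separate the points of L.  This last fact is the
   Poincare-Birkhoff-Witt theorem in dual form; it is proved by extending a
   functional degree by degree, choosing a totally ordered basis and recording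
   the corrections made by insertion sort. *)

(** * The enveloping relations and insertion sort *)

Section Sorting.
Variables (k : fieldType) (L : lmodType k) (br : {bilinear L -> L -> L}).
Hypothesis br_alt : forall x, br x x = 0.
Hypothesis br_jacobi : forall x y z,
  br x (br y z) + br y (br z x) + br z (br x y) = 0.
Variable leL : rel L.
Hypotheses (leL_total : total leL) (leL_trans : transitive leL)
  (leL_anti : antisymmetric leL).
Implicit Types (f g h : seq L -> k) (u v w s : seq L) (x y z : L).

(* A functional on the tensor algebra is encoded by its values on words. *)
Definition multilinear f := forall u v, scalar (fun x => f (u ++ x :: v)).

(* [swap_rel f f] says that [f] descends to the enveloping algebra; the case
   [f <> g] is needed because [f] is built one degree at a time. *)
Definition swap_rel f g := forall u x y v,
  f (u ++ x :: y :: v) - f (u ++ y :: x :: v) = g (u ++ br x y :: v).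

Fixpoint insert x s :=
  if s is y :: s' then if leL x y then x :: s else y :: insert x s' else [:: x].

Fixpoint isort s := if s is x :: s' then insert x (isort s') else [::].

(* If [swap_rel f g], then [insert_cost g x s = f (x :: s) - f (insert x s)];
   the definition makes sense before [f] is known. *)
Fixpoint insert_cost g x s :=
  if s is y :: s' then
    if leL x y then 0
    else g (br x y :: s') + insert_cost (fun w => g (y :: w)) x s'
  else 0.

(** By [sort_cost_swap] below, this is the only candidate for a functional that is related to [g] by
    [swap_rel] and vanishes on sorted words. *)
Fixpoint sort_cost g s :=
  if s is x :: s' then
    sort_cost (fun w => g (x :: w)) s' + insert_cost g x (isort s')
  else 0.

Lemma br_anti x y : br x y = - br y x.
Proof.
have := br_alt (x + y); rewrite linearDl !linearDr /= !br_alt add0r addr0.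
by move/eqP; rewrite addr_eq0 => /eqP.
Qed.

Lemma leL_refl x : leL x x.
Proof. by case/orP: (leL_total x x). Qed.

(** Hence words that differ by a swap have the same sorted form. Ties do no harm, since antisymmetry
    makes tied letters equal. *)
Lemma insertC x y s : insert x (insert y s) = insert y (insert x s).
Proof.
wlog le_xy : x y / leL x y => [wl|].
  by case/orP: (leL_total x y) => /wl.
have [<- //|neq_xy] := eqVneq x y.
have nle_yx : leL y x = false.
  by apply/negP => le_yx; rewrite (@leL_anti x y) ?le_xy ?eqxx in neq_xy.
elim: s => [|a s IHs] /=; first by rewrite le_xy nle_yx.
case: (boolP (leL y a)) => [le_ya|nle_ya] /=.
  by rewrite le_xy (leL_trans le_xy le_ya) /= nle_yx le_ya.
case: (boolP (leL x a)) => [le_xa|nle_xa] /=;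
  last by rewrite (negPf nle_ya) IHs.
by rewrite nle_yx (negPf nle_ya).
Qed.

Lemma eq_insert_cost f g x s : f =1 g -> insert_cost f x s = insert_cost g x s.
Proof.
elim: s f g => [|y s IHs] f g eq_fg //=; case: ifP => // _.
by rewrite eq_fg; congr (_ + _); apply: IHs => w; apply: eq_fg.
Qed.

Lemma insert_costB f g x s :
  insert_cost (fun w => f w - g w) x s = insert_cost f x s - insert_cost g x s.
Proof.
elim: s f g => [|y s IHs] f g /=; first by rewrite subrr.
by case: ifP => _; rewrite ?subrr // IHs; ring.
Qed.

Lemma eq_sort_cost f g s : f =1 g -> sort_cost f s = sort_cost g s.
Proof.
elim: s f g => [|y s IHs] f g eq_fg //=.
rewrite (eq_insert_cost _ _ eq_fg); congr (_ + _).
by apply: IHs => w; apply: eq_fg.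
Qed.

Lemma sort_costB f g s :
  sort_cost (fun w => f w - g w) s = sort_cost f s - sort_cost g s.
Proof.
elim: s f g => [|y s IHs] f g /=; first by rewrite subrr.
by rewrite IHs insert_costB; ring.
Qed.

Lemma swap_rel_cons f g x :
  swap_rel f g -> swap_rel (fun w => f (x :: w)) (fun w => g (x :: w)).
Proof. by move=> fg u y z v; apply: (fg (x :: u)). Qed.

Lemma insert_cost_swap f g x s :
  swap_rel f g -> insert_cost g x s = f (x :: s) - f (insert x s).
Proof.
elim: s f g => [|y s IHs] f g fg /=; first by rewrite subrr.
case: ifP => _; first by rewrite subrr.
rewrite (IHs _ _ (swap_rel_cons y fg)) -(fg [::]) /=; ring.
Qed.

Lemma sort_cost_swap f g s : swap_rel f g -> sort_cost g s = f s - f (isort s).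
Proof.
elim: s f g => [|x s IHs] f g fg /=; first by rewrite subrr.
rewrite (IHs _ _ (swap_rel_cons x fg)) (insert_cost_swap _ _ fg); ring.
Qed.

Lemma multilinear_cons f x : multilinear f -> multilinear (fun w => f (x :: w)).
Proof. by move=> f_lin u v; apply: (f_lin (x :: u)). Qed.

Lemma multilinearD f u v x y : multilinear f ->
  f (u ++ (x + y) :: v) = f (u ++ x :: v) + f (u ++ y :: v).
Proof. by move=> f_lin; have := f_lin u v 1 x y; rewrite scale1r mul1r. Qed.

Lemma multilinear0 f u v : multilinear f -> f (u ++ 0 :: v) = 0.
Proof.
move=> f_lin; have := multilinearD u v 0 0 f_lin.
by rewrite addr0 => /eqP; rewrite -subr_eq0 opprD addNKr oppr_eq0 => /eqP.
Qed.

Lemma multilinearN f u v x : multilinear f ->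
  f (u ++ - x :: v) = - f (u ++ x :: v).
Proof.
move=> f_lin; apply/eqP; rewrite -addr_eq0 -multilinearD // addNr.
by rewrite multilinear0.
Qed.

(** The confluence check for sorting. Only when both letters pass the head of [s] is there an
    overlap to resolve, and the Jacobi identity resolves it. *)
Lemma insert_cost_braid f g x z s : multilinear f -> multilinear g ->
    swap_rel f g ->
  insert_cost (fun w => f (x :: w)) z s + insert_cost f x (insert z s)
    - insert_cost (fun w => f (z :: w)) x s - insert_cost f z (insert x s)
  = f (br x z :: s).
Proof.
have br_swap h a b v : multilinear h -> h (br a b :: v) = - h (br b a :: v).
  by move=> h_lin; rewrite br_anti (multilinearN [::]).
(* At most one of the two orders of [x] and [z] costs a swap; for equal letters neither does, in
   agreement with [br_alt]. *)
have base h t : multilinear h -> (if leL x z then 0 else h (br x z :: t))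
    - (if leL z x then 0 else h (br z x :: t)) = h (br x z :: t).
  move=> h_lin; have [<-|neq_xz] := eqVneq x z.
    by rewrite leL_refl subr0 br_alt (multilinear0 [::]).
  case: (boolP (leL x z)) => [le_xz|nle_xz].
    case: (boolP (leL z x)) => [le_zx|nle_zx].
      by rewrite (@leL_anti x z) ?le_xz ?eqxx in neq_xz.
    by rewrite sub0r -br_swap.
  by have := leL_total x z; rewrite (negPf nle_xz) /= => ->; rewrite subr0.
elim: s f g => [|y s IHs] f g f_lin g_lin fg.
  by rewrite -[RHS]base //=; case: (leL x z); case: (leL z x); ring.
rewrite /=; case: (boolP (leL z y)) => le_zy;
  case: (boolP (leL x y)) => le_xy /=;
  rewrite ?le_zy ?(negPf le_zy) ?le_xy ?(negPf le_xy) /=.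
- by rewrite -[RHS]base //; case: (leL x z); case: (leL z x); ring.
- case: (boolP (leL x z)) => [le_xz|nle_xz].
    by rewrite (leL_trans le_xz le_zy) in le_xy.
  ring.
- case: (boolP (leL z x)) => [le_zx|nle_zx].
    by rewrite (leL_trans le_zx le_xy) in le_zy.
  rewrite (br_swap f x z) //; ring.
(* Both letters pass [y]. The induction hypothesis treats words starting with [y], [exch] accounts
   for exchanging [y] with the other letter, and [jac] cancels the double brackets. *)
have := IHs _ _ (multilinear_cons y f_lin) (multilinear_cons y g_lin)
    (swap_rel_cons y fg).
have /= exch a b : insert_cost (fun w => f (a :: y :: w)) b s
    - insert_cost (fun w => f (y :: a :: w)) b s
  = f (br a y :: b :: s) - f (br a y :: insert b s).
  rewrite -insert_costB -(insert_cost_swap _ _ (swap_rel_cons (br a y) fg)).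
  by apply: eq_insert_cost => w; apply: (fg [::]).
have jac : g (br x (br z y) :: s) - g (br z (br x y) :: s)
    - g (br (br x z) y :: s) = 0.
  rewrite -!(multilinearN [::]) // -!(multilinearD [::]) //.
  rewrite [X in g (X :: s)](_ : _ = 0) ?(multilinear0 [::]) //.
  rewrite (br_anti (br x z)) opprK -[RHS](br_jacobi x z y) (br_anti x y).
  by rewrite linearNr opprK.
move: jac; rewrite -!(fg [::]) /= => jac.
move: (exch x z) (exch z x) => exz ezx IH.
apply/eqP; rewrite -subr_eq0; apply/eqP.
(* The goal is a linear combination of the four hypotheses, which are inserted on the right as
   zeros. *)
rewrite -[RHS]jac -[RHS]addr0.
move/eqP: exz; rewrite -subr_eq0 => /eqP exz.
move/eqP: ezx; rewrite -subr_eq0 => /eqP ezx.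
move/eqP: IH; rewrite -subr_eq0 => /eqP IH.
rewrite -[in RHS]exz -[RHS]subr0 -[in RHS]ezx -[RHS]addr0 -[in RHS]IH.
ring.
Qed.

(** The passage to the next degree: the common tail is sorted first, then [insert_cost_braid]
    compares the two insertions. As [sort_cost f] depends on the order, it need not be multilinear;
    [extend] repairs this later. *)
Lemma sort_cost_rel f g : multilinear f -> multilinear g -> swap_rel f g ->
  swap_rel (sort_cost f) f.
Proof.
have isortC u x z v : isort (u ++ x :: z :: v) = isort (u ++ z :: x :: v).
  by elim: u => [|a u IHu] /=; [apply: insertC | rewrite IHu].
move=> f_lin g_lin fg u x z v.
elim: u f g f_lin g_lin fg => [|a u IHu] f g f_lin g_lin fg /=.
  set s := isort v.
  have := insert_cost_braid x z s f_lin g_lin fg => braid.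
  have := sort_cost_swap v (swap_rel_cons (br x z) fg).
  rewrite -braid -/s => /eqP; rewrite -subr_eq0 => /eqP swp.
  have := sort_costB (fun w => f (x :: z :: w)) (fun w => f (z :: x :: w)) v.
  rewrite (@eq_sort_cost _ (fun w => g (br x z :: w))) => [|w];
    last exact: (fg [::]).
  move=> /eqP; rewrite -subr_eq0 => /eqP dif.
  apply/eqP; rewrite -subr_eq0; apply/eqP; rewrite -[RHS]subr0 -{1}swp -dif.
  ring.
rewrite -(IHu _ _ (multilinear_cons a f_lin) (multilinear_cons a g_lin)
  (swap_rel_cons a fg)).
by rewrite isortC; ring.
Qed.
End Sorting.

(** * Coordinates in a well-ordered basis *)

Section LinearSection.
Variables (k : fieldType) (L : lmodType k).
Implicit Types (s : seq (k * L)) (x y : L) (g : L -> k).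

(** Lists of pairs represent elements of the free module on the set [L]; [formal_lift g] is the
    linear extension of [g] to it. *)
Definition combination s : L := \sum_(p <- s) p.1 *: p.2.

Definition formal_lift g s : k := \sum_(p <- s) p.1 * g p.2.

Definition scale_formal (a : k) s := [seq (a * p.1, p.2) | p <- s].

Lemma combination_cat s t :
  combination (s ++ t) = combination s + combination t.
Proof. exact: big_cat. Qed.

Lemma formal_lift_cat g s t :
  formal_lift g (s ++ t) = formal_lift g s + formal_lift g t.
Proof. exact: big_cat. Qed.

Lemma combination_scale a s :
  combination (scale_formal a s) = a *: combination s.
Proof.
rewrite /combination big_map scaler_sumr.
by apply: eq_bigr => p _; rewrite scalerA.
Qed.

Lemma formal_lift_scale g a s :
  formal_lift g (scale_formal a s) = a * formal_lift g s.
Proof.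
rewrite /formal_lift big_map mulr_sumr.
by apply: eq_bigr => p _; rewrite mulrA.
Qed.

Section Basis.
Variable leL : rel L.
Hypothesis leL_wo : well_order leL.

Definition below x s := all (fun p => (p.2 != x) && leL p.2 x) s.

(* The elements which are not combinations of smaller ones form a basis. *)
Definition in_basis x := ~ exists2 s, below x s & combination s = x.

Definition basis_spanned x :=
  exists2 s, forall p, p \in s -> in_basis p.2 & combination s = x.

Let leL_chain : wo_chain leL predT.
Proof. by move=> A _; apply: leL_wo. Qed.

Lemma wo_total : total leL.
Proof. by move=> x y; apply: (wo_chainW leL_chain). Qed.

Lemma wo_anti : antisymmetric leL.
Proof. by move=> x y; apply: (wo_chain_antisymmetric leL_chain). Qed.

(** The least of the three elements decides: if it is [y] or [z], antisymmetry identifies two of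
    them. *)
Lemma wo_trans : transitive leL.
Proof.
move=> y x z le_xy le_yz.
have [|m [[m_in lb] _]] := leL_wo (A := [pred t | t \in [:: x; y; z]]).
  by exists x; rewrite inE !inE eqxx.
have [lx ly lz] : [/\ leL m x, leL m y & leL m z].
  by split; apply: lb; rewrite inE !inE eqxx ?orbT.
move: m_in; rewrite inE !inE => /or3P[] /eqP m_eq; rewrite m_eq // in lx ly lz.
  by rewrite (wo_anti (x := x) (y := y)) ?le_xy.
by rewrite -(wo_anti (x := y) (y := z)) ?le_yz.
Qed.

Lemma seq_maximum s : s != [::] ->
  exists2 m, m \in [seq p.2 | p <- s] & all (fun p => leL p.2 m) s.
Proof.
elim: s => [//|p s IHs] _; case: (eqVneq s [::]) => [->|/IHs[m ms /allP max_m]].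
  by exists p.2; rewrite /= ?mem_head // andbT; case/orP: (wo_total p.2 p.2).
case/orP: (wo_total p.2 m) => le_pm.
  by exists m; rewrite /= ?inE ?ms ?orbT // le_pm; apply/allP.
exists p.2; rewrite /= ?mem_head //; apply/andP; split.
  by case/orP: (wo_total p.2 p.2).
by apply/allP => q /max_m /wo_trans; apply.
Qed.

(** A least vector that is not spanned would be a basis element or a combination of smaller, hence
    spanned, vectors. *)
Lemma basis_span x : basis_spanned x.
Proof.
have spanD s : (forall p, p \in s -> basis_spanned p.2) ->
    basis_spanned (combination s).
  elim: s => [|p s IHs] spans; first by exists [::].
  have [t tX tE] := spans p (mem_head _ _).
  have [q qs|u uX uE] := IHs; first by apply: spans; rewrite inE qs orbT.
  exists (scale_formal p.1 t ++ u) => [q|].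
    by rewrite mem_cat => /orP[/mapP[r /tX rX ->]|/uX].
  by rewrite combination_cat combination_scale tE uE /combination big_cons.
apply: contrapT => nspan_x.
have [|z [[z_bad z_min] _]] :=
  leL_wo (A := [pred t | `[< ~ basis_spanned t >]]).
  by exists x; rewrite inE; apply/asboolP.
move: z_bad; rewrite inE => /asboolP nspan_z.
have [[s /allP s_lt sE]|zX] :=
  pselect (exists2 s, below z s & combination s = z).
  apply: nspan_z; rewrite -sE; apply: spanD => p /s_lt /andP[neq_pz le_pz].
  apply: contrapT => nspan_p; case/negP: neq_pz; apply/eqP.
  apply: wo_anti; rewrite le_pz z_min //.
  by rewrite inE; apply/asboolP.
apply: nspan_z; exists [:: (1, z)] => [p|].
  by rewrite inE => /eqP->.
by rewrite /combination big_seq1 scale1r.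
Qed.

Lemma basis_free s g : (forall p, p \in s -> in_basis p.2) ->
  combination s = 0 -> formal_lift g s = 0.
Proof.
have [n] := ubnP (size s); elim: n s => // n IHn s.
have [->|/seq_maximum[m /mapP[q qs mE] /allP max_m]] := eqVneq s [::].
  by rewrite /formal_lift big_nil.
rewrite ltnS => size_s sX s0.
pose t := [seq p <- s | p.2 != m]; pose a := \sum_(p <- s | p.2 == m) p.1.
have combE : combination s = a *: m + combination t.
  rewrite /combination (bigID (fun p => p.2 == m)) big_filter scaler_suml /=.
  by congr (_ + _); apply: eq_bigr => p /eqP->.
have liftE : formal_lift g s = a * g m + formal_lift g t.
  rewrite /formal_lift (bigID (fun p => p.2 == m)) big_filter mulr_suml /=.
  by congr (_ + _); apply: eq_bigr => p /eqP->.
have [a0|a_neq0] := eqVneq a 0; last first.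
  case: (sX q qs); rewrite -mE; exists (scale_formal (- a^-1) t).
    apply/allP => p /mapP[r]; rewrite mem_filter => /andP[neq_rm rs] ->.
    by rewrite /= neq_rm max_m.
  rewrite combination_scale; apply: (scalerI a_neq0).
  rewrite scalerA mulrN divff // scaleN1r; apply/eqP.
  by rewrite eq_sym -addr_eq0 -combE s0.
rewrite liftE a0 mul0r add0r IHn //.
- apply: leq_trans size_s.
  rewrite size_filter -(count_predC (fun p => p.2 != m)).
  rewrite -addn1 leq_add2l -has_count; apply/hasP; exists q => //=.
  by rewrite mE eqxx.
- by move=> p; rewrite mem_filter => /andP[_ /sX].
- by rewrite -s0 combE a0 scale0r add0r.
Qed.

End Basis.

(** Linearity is asked only after [formal_lift], since different lists may represent the same formal
    sum. *)
Lemma linear_section : exists S : L -> seq (k * L),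
  (forall x, combination (S x) = x) /\
  (forall g, scalar (fun x => formal_lift g (S x))).
Proof.
have [leL leL_wo] := well_ordering_principle L.
have span x : {s | (forall p, p \in s -> in_basis leL p.2) & combination s = x}.
  by apply: cid2; apply: basis_span.
exists (fun x => s2val (span x)); split=> [x|g a x y]; first by case: (span x).
case: (span _) (span x) (span y) => /= s sX sE [t tX tE] [u uX uE].
apply/eqP; rewrite -subr_eq0; apply/eqP.
have /= <- := basis_free leL_wo
  (s := s ++ scale_formal (- a) t ++ scale_formal (- 1) u) g.
- by rewrite !formal_lift_cat !formal_lift_scale; ring.
- move=> p; rewrite !mem_cat => /or3P[/sX //||] /mapP[q qs ->];
    [exact: tX q qs|exact: uX q qs].
- rewrite !combination_cat !combination_scale sE tE uE.
  by rewrite scaleN1r scaleNr -opprD subrr.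
Qed.

(** Indicator functions of single vectors extract the total coefficients. *)
Lemma separating_lift s : combination s != 0 -> exists g, formal_lift g s != 0.
Proof.
apply: contraPP => /forallNP lift0; apply/negP; rewrite negbK; apply/eqP.
pose B := undup [seq p.2 | p <- s].
transitivity (\sum_(b <- B) (\sum_(p <- s) p.1 * (p.2 == b)%:R) *: b).
  rewrite /combination; under [RHS]eq_bigr do rewrite scaler_suml.
  rewrite exchange_big; apply: eq_big_seq => p ps /=.
  rewrite (bigD1_seq p.2) ?undup_uniq ?mem_undup ?map_f //=.
  rewrite eqxx mulr1 big1 ?addr0 // => b; rewrite eq_sym => /negPf->.
  by rewrite mulr0 scale0r.
rewrite big1 // => b _; have /negP := lift0 (fun x => (x == b)%:R).
by rewrite negbK => /eqP; rewrite /formal_lift => ->; rewrite scale0r.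
Qed.
End LinearSection.

(** * Separation by functionals on the enveloping algebra *)

Section Extension.
Variables (k : fieldType) (L : lmodType k) (br : {bilinear L -> L -> L}).
Variable S : L -> seq (k * L).
Hypotheses (S_comb : forall x, combination (S x) = x)
  (S_lin : forall g, scalar (fun x => formal_lift g (S x))).
Implicit Types (f g : seq L -> k) (u v w : seq L) (x y : L) (s : seq (k * L)).

Lemma eq_formal_lift (g h : L -> k) s :
  g =1 h -> formal_lift g s = formal_lift h s.
Proof. by move=> gh; apply: eq_bigr => p _; rewrite gh. Qed.

Lemma formal_liftP a (g h : L -> k) s :
  formal_lift (fun b => a * g b + h b) s
  = a * formal_lift g s + formal_lift h s.
Proof.
rewrite /formal_lift mulr_sumr -big_split; apply: eq_bigr => p _ /=; ring.
Qed.

Lemma formal_lift_combination (l : L -> k) s :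
  scalar l -> formal_lift l s = l (combination s).
Proof.
move=> l_lin; have lD x y a : l (a *: x + y) = a * l x + l y by apply: l_lin.
have l0 : l 0 = 0.
  by have /eqP := lD 0 0 (- 1); rewrite scaler0 addr0 mulN1r addNr => /eqP.
elim: s => [|p s IHs]; first by rewrite /formal_lift /combination !big_nil l0.
by move: IHs; rewrite /formal_lift /combination !big_cons lD => ->.
Qed.

Lemma exchange_formal_lift (F : L -> L -> k) s t :
  formal_lift (fun b => formal_lift (F b) t) s
  = formal_lift (fun c => formal_lift (F^~ c) s) t.
Proof.
rewrite /formal_lift; under eq_bigr do rewrite mulr_sumr.
under [RHS]eq_bigr do rewrite mulr_sumr.
by rewrite exchange_big; apply: eq_bigr => p _; apply: eq_bigr => q _ /=; ring.
Qed.

(* The multilinear function whose values on words of basis vectors are those of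
   [f]: [S x] lists the coordinates of [x]. *)
Fixpoint extend f w : k :=
  if w is x :: w' then
    formal_lift (fun b => extend (fun v => f (b :: v)) w') (S x)
  else f [::].

Lemma eq_extend f g w : f =1 g -> extend f w = extend g w.
Proof.
elim: w f g => [|x w IHw] f g fg //=.
by apply: eq_formal_lift => b; apply: IHw => v; apply: fg.
Qed.

Lemma extendP a f g w :
  extend (fun v => a * f v + g v) w = a * extend f w + extend g w.
Proof.
elim: w f g => [|x w IHw] f g //=; rewrite -formal_liftP.
by apply: eq_formal_lift => b; apply: IHw.
Qed.

Lemma extend_multilinear f : multilinear (extend f).
Proof.
move=> u v; elim: u f => [|x u IHu] f a y z /=; first exact: S_lin.
by rewrite -formal_liftP; apply: eq_formal_lift => b; apply: IHu.
Qed.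

Lemma extend_id f : multilinear f -> extend f =1 f.
Proof.
move=> f_lin w; elim: w f f_lin => [|x w IHw] f f_lin //=.
rewrite (eq_formal_lift (h := fun b => f (b :: w))) => [|b].
  by rewrite formal_lift_combination ?S_comb //; apply: (f_lin [::]).
by apply: IHw; apply: multilinear_cons.
Qed.

(** Coordinates of [x] and [y] reduce the relation to letters of [S x] and [S y]; linearity of [g]
    and [br] reassembles the right side. *)
Lemma extend_swap f g : multilinear g -> swap_rel br f g ->
  swap_rel br (extend f) g.
Proof.
move=> g_lin fg u x y v; elim: u f g g_lin fg => [|a u IHu] f g g_lin fg /=.
  rewrite [X in _ - X]exchange_formal_lift -mulN1r addrC -formal_liftP.
  transitivity (formal_lift
    (fun b => formal_lift (fun c => g (br b c :: v)) (S y)) (S x)).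
    apply: eq_formal_lift => b; rewrite -formal_liftP.
    apply: eq_formal_lift => c.
    rewrite -extendP -(extend_id (multilinear_cons (br b c) g_lin)).
    by apply: eq_extend => w; rewrite mulN1r addrC; apply: (fg [::]).
  rewrite formal_lift_combination => [|c b b'].
    rewrite S_comb formal_lift_combination => [|c b b'].
      by rewrite S_comb.
    by rewrite linearPr; apply: (g_lin [::]).
  rewrite -formal_liftP; apply: eq_formal_lift => d.
  by rewrite linearPl; apply: (g_lin [::]).
rewrite -mulN1r addrC -formal_liftP -[RHS](extend_id g_lin) /=.
apply: eq_formal_lift => b.
rewrite [RHS]extend_id; last exact: multilinear_cons.
rewrite mulN1r addrC; apply: (IHu _ (fun w => g (b :: w))).
  exact: multilinear_cons.
exact: swap_rel_cons.
Qed.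
End Extension.

Theorem separating_functional (k : fieldType) (L : lmodType k)
    (br : {bilinear L -> L -> L}) (y : L) :
  (forall x, br x x = 0) ->
  (forall x y z, br x (br y z) + br y (br z x) + br z (br x y) = 0) ->
  y != 0 ->
  exists f : seq L -> k,
    [/\ multilinear f, swap_rel br f f & f [:: y] != 0].
Proof.
move=> br_alt br_jacobi y_neq0.
have [leL leL_wo] := well_ordering_principle L.
have [S [S_comb S_lin]] := linear_section L.
have [g gy] : exists g, formal_lift g (S y) != 0.
  by apply: separating_lift; rewrite S_comb.
(* The degree one component. A swap needs two letters, so [f0] is related to zero. *)
pose f0 w := if w is [:: x] then formal_lift g (S x) else 0.
have f0_lin : multilinear f0.
  move=> [|x [|x' u]] [|z v] a b c /=; rewrite ?mulr0 ?addr0 //; exact: S_lin.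
have f0_swap : swap_rel br f0 (fun=> 0).
  by move=> [|x [|x' u]] a b v; rewrite /= subrr.
pose f n := iter n (fun h => extend S (sort_cost br leL h)) f0.
have f_lin n : multilinear (f n).
  by case: n => [|n] //; apply: extend_multilinear.
have f_swap n : swap_rel br (f n.+1) (f n).
  have step h h' : multilinear h -> multilinear h' -> swap_rel br h h' ->
      swap_rel br (extend S (sort_cost br leL h)) h.
    move=> h_lin h'_lin hh'; apply: extend_swap => //.
    by apply: sort_cost_rel h_lin h'_lin hh' => //;
      [apply: wo_total | apply: wo_trans | apply: wo_anti].
  elim: n => [|n IHn]; last exact: step IHn.
  by apply: step f0_swap => // u v a b c; rewrite mulr0 addr0.
(* [f n] is the component of degree [n.+1] of the functional. *)
exists (fun w => f (size w).-1 w); split=> //.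
  move=> u v a b c; rewrite !size_cat /=; exact: f_lin.
move=> u a b v; rewrite !size_cat /= !addnS /=; exact: f_swap.
Qed.

(** * The postassociative algebra of operators on functionals *)

Section Endomorphisms.
Variables (k : fieldType) (V : lmodType k).

Definition linear_pred : {pred V -> V} := fun f => `[< linear f >].

Fact linear_submod_closed : submod_closed linear_pred.
Proof.
split=> [|a f g /asboolP f_lin /asboolP g_lin]; apply/asboolP => b x y.
  by rewrite scaler0 addr0.
rewrite -[LHS]/(a *: f (b *: x + y) + g (b *: x + y)) f_lin g_lin.
rewrite -[RHS]/(b *: (a *: f x + g x) + (a *: f y + g y)).
by rewrite !scalerDr !scalerA [a * b]mulrC addrACA.
Qed.

HB.instance Definition _ :=
  GRing.isSubmodClosed.Build k (V -> V) linear_pred linear_submod_closed.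

Record endo := Endo { endo_fun :> V -> V; _ : endo_fun \in linear_pred }.
HB.instance Definition _ := [isSub for endo_fun].
HB.instance Definition _ := [Choice of endo by <:].
HB.instance Definition _ := [SubChoice_isSubLmodule of endo by <:].

Fact endo_is_linear (f : endo) : linear f.
Proof. by case: f => f f_lin; apply/asboolP. Qed.
HB.instance Definition _ (f : endo) :=
  GRing.isLinear.Build k V V *:%R f (endo_is_linear f).

Definition linear_endo (f : V -> V) (f_lin : linear f) : endo :=
  Endo (asboolT f_lin : f \in linear_pred).

Lemma endo_eq (f g : endo) : f =1 g -> f = g.
Proof. by move=> fg; apply/val_inj/funext. Qed.

Fact comp_linear (f g : endo) : linear (f \o g).
Proof. by move=> a x y /=; rewrite !linearP. Qed.

Definition endo_comp f g := linear_endo (comp_linear f g).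

Fact endo_comp_bilinear : bilinear_for *:%R *:%R endo_comp.
Proof.
by split=> h a f g; apply: endo_eq => x //=; apply: linearP.
Qed.
HB.instance Definition _ :=
  bilinear_isBilinear.Build k endo endo endo *:%R *:%R
    endo_comp endo_comp_bilinear.

Lemma endo_compA f g h :
  endo_comp (endo_comp f g) h = endo_comp f (endo_comp g h).
Proof. exact: endo_eq. Qed.
End Endomorphisms.

(** * The dual of the enveloping algebra, and projecting onto operators that commute with
    translations *)

Section LieFunctionals.
Variables (k : fieldType) (L : lmodType k) (br : {bilinear L -> L -> L}).

Definition lie_functional_pred : {pred seq L -> k^o} :=
  fun f => `[< multilinear f /\ swap_rel br f f >].

Lemma lie_functionalP f :
  reflect (multilinear f /\ swap_rel br f f) (f \in lie_functional_pred).
Proof. exact: asboolP. Qed.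

Fact lie_functional_submod_closed : submod_closed lie_functional_pred.
Proof.
split=> [|a f g /lie_functionalP[f_lin f_swap] /lie_functionalP[g_lin g_swap]];
  apply/lie_functionalP.
  by split=> [u v b x y|u x y v]; rewrite ?mulr0 ?addr0 ?subrr.
split=> [u v b x y|u x y v].
  rewrite -[LHS]/(a * f _ + g _) -[RHS]/(b * (a * f _ + g _) + (a * f _ + g _)).
  by rewrite f_lin g_lin; ring.
rewrite -[LHS]/(a * f _ + g _ - (a * f _ + g _)) -[RHS]/(a * f _ + g _).
by rewrite -f_swap -g_swap; ring.
Qed.

HB.instance Definition _ := GRing.isSubmodClosed.Build k (seq L -> k^o)
  lie_functional_pred lie_functional_submod_closed.

Record lie_functional := LieFunctional {
  functional_val :> seq L -> k^o; _ : functional_val \in lie_functional_pred }.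
HB.instance Definition _ := [isSub for functional_val].
HB.instance Definition _ := [Choice of lie_functional by <:].
HB.instance Definition _ := [SubChoice_isSubLmodule of lie_functional by <:].

Implicit Types (f g : lie_functional) (u v w : seq L).
Implicit Types F G : endo lie_functional.

Lemma functional_eq f g : f =1 g -> f = g.
Proof. by move=> fg; apply/val_inj/funext. Qed.

Lemma functional_multilinear f : multilinear f.
Proof. by case: f => f fP; case/lie_functionalP: (fP). Qed.

Lemma functional_swap f : swap_rel br f f.
Proof. by case: f => f fP; case/lie_functionalP: (fP). Qed.

Definition make_functional (f : seq L -> k^o) (f_lin : multilinear f)
    (f_swap : swap_rel br f f) : lie_functional :=
  LieFunctional (introT (lie_functionalP f) (conj f_lin f_swap)).

Fact translate_multilinear v f : multilinear (fun u => f (u ++ v)).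
Proof.
by move=> u w a x y; rewrite -!catA; apply: functional_multilinear.
Qed.

Fact translate_swap v f :
  swap_rel br (fun u => f (u ++ v)) (fun u => f (u ++ v)).
Proof. by move=> u x y w; rewrite -!catA; apply: functional_swap. Qed.

(** The transpose of right multiplication by [v] on the enveloping algebra. *)
Definition translate v f :=
  make_functional (translate_multilinear v f) (translate_swap v f).

Fact project_multilinear F f : multilinear (fun u => F (translate u f) [::]).
Proof.
move=> u v a x y.
have -> : translate (u ++ (a *: x + y) :: v) f
    = a *: translate (u ++ x :: v) f + translate (u ++ y :: v) f.
  apply: functional_eq => w /=.
  by rewrite -[RHS]/(a * f _ + f _) !catA; apply: functional_multilinear.
by rewrite linearP.
Qed.

Fact project_swap F f : swap_rel br
  (fun u => F (translate u f) [::]) (fun u => F (translate u f) [::]).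
Proof.
move=> u x y v.
have <- : translate (u ++ x :: y :: v) f - translate (u ++ y :: x :: v) f
    = translate (u ++ br x y :: v) f.
  apply: functional_eq => w /=.
  by rewrite -[LHS]/(f _ - f _) !catA; apply: functional_swap.
by rewrite linearB.
Qed.

(* The operator commuting with translations which agrees with [F] at the empty
   word. *)
Definition project_fun F f :=
  make_functional (project_multilinear F f) (project_swap F f).

Fact project_fun_linear F : linear (project_fun F).
Proof.
move=> a f g; apply: functional_eq => u /=.
have -> : translate u (a *: f + g) = a *: translate u f + translate u g.
  exact: functional_eq.
by rewrite linearP.
Qed.

Definition project F : endo lie_functional :=
  linear_endo (project_fun_linear F).

Fact project_is_linear : linear project.
Proof.
by move=> a F G; apply: endo_eq => f; apply: functional_eq => u.
Qed.
HB.instance Definition _ := GRing.isLinear.Build k (endo lie_functional)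
  (endo lie_functional) *:%R project project_is_linear.

(** The left side commutes with translations, so comparison at the empty word suffices. There
    [project F] agrees with [F], and the first and third terms on the right cancel. *)
Lemma project_comp F G : endo_comp (project F) (project G)
  = project (endo_comp (project F) G + endo_comp F (project G) - endo_comp F G).
Proof.
apply: endo_eq => f; apply: functional_eq => u.
have tr_project H v g : translate v (project H g) = project H (translate v g).
  apply: functional_eq => w /=; congr (H _ _); apply: functional_eq => t /=.
  by rewrite catA.
set X := endo_comp (project F) G + _ - _.
rewrite -[RHS]/(X (translate u f) [::]).
rewrite -[LHS]/(F (translate u (project G f)) [::]) tr_project.
move: (translate u f) => g.
have -> : X g [::] = F (translate [::] (G g)) [::] + F (project G g) [::]
    - F (G g) [::] by [].
have -> : translate [::] (G g) = G g.
  by apply: functional_eq => w /=; rewrite cats0.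
by rewrite addrAC subrr add0r.
Qed.

End LieFunctionals.

(** * The Rota-Baxter operator and its postassociative products *)

Section RotaBaxter.
Variables (k : fieldType) (L : lmodType k) (br : {bilinear L -> L -> L}).
Local Notation B := (endo (lie_functional br)).
Implicit Types F G H : B.

Definition rb_succ F G : B := - endo_comp (project F) G.
Definition rb_prec F G : B := - endo_comp F (project G).

Fact rb_succ_bilinear : bilinear_for *:%R *:%R rb_succ.
Proof.
split=> H a F G; rewrite /rb_succ.
  by rewrite linearP linearPl /= opprD -scalerN.
by rewrite linearPr /= opprD -scalerN.
Qed.

Fact rb_prec_bilinear : bilinear_for *:%R *:%R rb_prec.
Proof.
split=> H a F G; rewrite /rb_prec.
  by rewrite linearPl /= opprD -scalerN.
by rewrite linearP linearPr /= opprD -scalerN.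
Qed.

(** The Rota-Baxter identity of weight 1 for [- project]. The two axioms with a threefold sum rest
    on it; the other five follow from associativity of composition. *)
Let project_rb F G : project (rb_succ F G + rb_prec F G + endo_comp F G)
  = - endo_comp (project F) (project G).
Proof. by rewrite project_comp -linearN /rb_succ /rb_prec !opprD opprK. Qed.

Fact rb_precA F G H : rb_prec (rb_prec F G) H =
  rb_prec F (rb_succ G H + rb_prec G H + endo_comp G H).
Proof.
by rewrite {1 3}/rb_prec project_rb /rb_prec linearNl linearNr /= endo_compA.
Qed.

Fact rb_succ_precA F G H : rb_prec (rb_succ F G) H = rb_succ F (rb_prec G H).
Proof. by rewrite /rb_prec /rb_succ linearNl linearNr /= endo_compA. Qed.

Fact rb_succA F G H :
  rb_succ (rb_succ F G + rb_prec F G + endo_comp F G) H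
  = rb_succ F (rb_succ G H).
Proof.
by rewrite {1}/rb_succ project_rb /rb_succ linearNl linearNr /= endo_compA.
Qed.

Fact rb_succ_mulA F G H :
  rb_succ F (endo_comp G H) = endo_comp (rb_succ F G) H.
Proof. by rewrite /rb_succ linearNl /= endo_compA. Qed.

Fact rb_prec_mul_succ F G H :
  endo_comp (rb_prec F G) H = endo_comp F (rb_succ G H).
Proof. by rewrite /rb_prec /rb_succ linearNl linearNr /= endo_compA. Qed.

Fact rb_mul_precA F G H :
  rb_prec (endo_comp F G) H = endo_comp F (rb_prec G H).
Proof. by rewrite /rb_prec linearNr /= endo_compA. Qed.

HB.instance Definition _ := Lmodule_isPostAss.Build k B
  (@endo_comp_bilinear k (lie_functional br)) rb_succ_bilinear rb_prec_bilinear
  rb_precA rb_succ_precA rb_succA rb_succ_mulA rb_prec_mul_succ rb_mul_precA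
  (@endo_compA k (lie_functional br)).
End RotaBaxter.

(** * The embedding *)

Local Ltac zmod_cancel :=
  apply/eqP; rewrite -subr_eq0; apply/eqP;
  rewrite ?(opprD, opprK) -[LHS]addr0 -!addrA;
  repeat match goal with
  | |- - ?a + _ = 0 => rewrite !(addrCA _ a) addNKr
  | |- ?a + _ = 0 => rewrite !(addrCA _ (- a)) addKr
  end.

Section SubAdjacent.
Variables (k : fieldType) (L : postLieType k).
Implicit Types x y z : L.

(** The first post-Lie axiom says that left multiplications by [plmul] represent this bracket on
    [L]. *)
Definition sub_adjacent x y : L := plmul x y - plmul y x + lie x y.

Fact sub_adjacent_bilinear : bilinear_for *:%R *:%R sub_adjacent.
Proof.
split=> u a x y; rewrite /sub_adjacent /= !(linearPl, linearPr) /=;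
  by rewrite opprD !scalerDr scalerN [X in X + _ = _]addrACA [LHS]addrACA.
Qed.
HB.instance Definition _ := bilinear_isBilinear.Build k L L L *:%R *:%R
  sub_adjacent sub_adjacent_bilinear.

Fact sub_adjacent_alternating x : sub_adjacent x x = 0.
Proof. by rewrite /sub_adjacent subrr add0r lie_alternating. Qed.

Lemma lie_anti x y : lie x y = - lie y x.
Proof. exact: br_anti (@lie_alternating k L) x y. Qed.

(** Once the post-Lie axioms have expanded the mixed terms, only the Jacobi sum of [lie]
    survives. *)
Fact sub_adjacent_jacobi x y z :
  sub_adjacent x (sub_adjacent y z) + sub_adjacent y (sub_adjacent z x)
    + sub_adjacent z (sub_adjacent x y) = 0.
Proof.
rewrite /sub_adjacent !(linearDl, linearDr, linearNl, linearNr) /=.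
rewrite -!plmul_assoc_lie !plmul_lie.
rewrite !(lie_anti _ (plmul _ _)).
by rewrite -[RHS](lie_jacobi x y z); zmod_cancel.
Qed.
End SubAdjacent.

(** * The homomorphism from [L] to operators on functionals *)

Section RightAction.
Variables (k : fieldType) (L : postLieType k).
Local Notation br := (@sub_adjacent k L).
Implicit Types (f g : seq L -> k) (x y z : L) (u v w : seq L).

(* This is [i y f u]; the recursion is [R(i x), i y] = i (x . y), since
   [R(i x) f u = - f (x :: u)]. *)
Fixpoint right_act y f u : k :=
  if u is x :: u' then
    right_act y (fun w => f (x :: w)) u' - right_act (plmul x y) f u'
  else f [:: y].

Lemma eq_right_act y f g u : f =1 g -> right_act y f u = right_act y g u.
Proof.
elim: u y f g => [|x u IHu] y f g fg /=; first exact: fg.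
by congr (_ - _); apply: IHu => // w; apply: fg.
Qed.

Lemma right_actP y a f g u : right_act y (fun w => a * f w + g w) u
  = a * right_act y f u + right_act y g u.
Proof. by elim: u y f g => [|x u IHu] y f g //=; rewrite !IHu; ring. Qed.

Lemma right_actB y f g u : right_act y (fun w => f w - g w) u
  = right_act y f u - right_act y g u.
Proof. by elim: u y f g => [|x u IHu] y f g //=; rewrite !IHu; ring. Qed.

Lemma right_act_scalar f u : multilinear f -> scalar (fun y => right_act y f u).
Proof.
elim: u f => [|x u IHu] f f_lin a y z /=; first exact: (f_lin [::]).
have -> : plmul x (a *: y + z) = a *: plmul x y + plmul x z by rewrite linearPr.
rewrite !IHu //; first by ring.
exact: multilinear_cons.
Qed.

Lemma right_act_multilinear y f : multilinear f -> multilinear (right_act y f).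
Proof.
move=> f_lin u v; elim: u y f f_lin => [|x u IHu] y f f_lin a b c /=.
  have -> : plmul (a *: b + c) y = a *: plmul b y + plmul c y.
    by rewrite linearPl.
  rewrite right_act_scalar //.
  rewrite (@eq_right_act _ _ (fun w => a * f (b :: w) + f (c :: w))) ?right_actP.
    ring.
  by move=> w; apply: (f_lin [::]).
by rewrite !IHu //; [ring | apply: multilinear_cons].
Qed.

Lemma right_actBl y z f u : multilinear f ->
  right_act (y - z) f u = right_act y f u - right_act z f u.
Proof.
move=> f_lin; rewrite addrC -scaleN1r right_act_scalar //; ring.
Qed.

(** At the front, the terms in which just one of [a], [b] acts on [y] cancel; the rest is the action
    of [br a b] on [y]. *)
Lemma right_act_swap y f : multilinear f -> swap_rel br f f ->
  swap_rel br (right_act y f) (right_act y f).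
Proof.
move=> f_lin f_swap u a b v.
elim: u y f f_lin f_swap => [|x u IHu] y f f_lin f_swap /=; last first.
  rewrite -!IHu //; [ring|exact: multilinear_cons|exact: swap_rel_cons].
have actE : plmul (br a b) y = plmul a (plmul b y) - plmul b (plmul a y).
  rewrite /sub_adjacent linearDl linearBl /= -plmul_assoc_lie.
  by zmod_cancel.
rewrite actE right_actBl //.
rewrite -(@eq_right_act _ (fun w => f (a :: b :: w) - f (b :: a :: w))
  (fun w => f (br a b :: w))).
  rewrite right_actB; ring.
by move=> w; apply: (f_swap [::]).
Qed.

(** At the empty word the swap relation yields [br y z], which the [plmul] terms reduce to
    [lie y z]. The induction step uses the derivation axiom [plmul_lie]. *)
Lemma right_act_comm y z f u : multilinear f -> swap_rel br f f ->
  right_act y (right_act z f) u - right_act z (right_act y f) u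
  = right_act (lie y z) f u.
Proof.
move=> f_lin f_swap.
elim: u y z f f_lin f_swap => [|x u IHu] y z f f_lin f_swap /=.
  have /= swp := f_swap [::] y z [::].
  rewrite (_ : lie y z = br y z - (plmul y z - plmul z y)); last first.
    by rewrite /sub_adjacent addrC addKr.
  have fB (b c : L) : f [:: b - c] = f [:: b] - f [:: c].
    by rewrite (multilinearD [::]) // (multilinearN [::]).
  by rewrite !fB -swp; ring.
rewrite plmul_lie !right_actB.
have -> : lie (plmul x y) z + lie y (plmul x z)
    = 1 *: lie (plmul x y) z + lie y (plmul x z).
  by rewrite scale1r.
rewrite right_act_scalar // -!IHu //; first by ring.
  exact: multilinear_cons.
exact: swap_rel_cons.
Qed.

Local Notation functional := (lie_functional br).

Definition right_act_fun y (f : functional) : functional :=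
  make_functional (right_act_multilinear y (functional_multilinear f))
    (right_act_swap y (functional_multilinear f) (functional_swap f)).

Fact right_act_fun_linear y : linear (right_act_fun y).
Proof. by move=> a f g; apply: functional_eq => u; apply: right_actP. Qed.

Definition embedding y : (endo functional)^(-) :=
  linear_endo (right_act_fun_linear y).

Fact embedding_linear : linear embedding.
Proof.
move=> a y z; apply: endo_eq => f; apply: functional_eq => u.
exact/right_act_scalar/functional_multilinear.
Qed.
HB.instance Definition _ := GRing.isLinear.Build k L (endo functional)^(-) *:%R
  embedding embedding_linear.

Lemma embedding_hom : postlie_hom embedding.
Proof.
split=> y z; apply: endo_eq => f; apply: functional_eq => u.
  apply/esym/right_act_comm; first exact: functional_multilinear.
  exact: functional_swap.
(* Since [project (embedding y)] prepends [y] to the argument of a functional, the post-Lie product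
   unfolds to the recursion of [right_act]. *)
rewrite -[RHS]/(- right_act z f (y :: u)
  - - right_act z (fun w => f (y :: w)) u).
by rewrite -[LHS]/(right_act (plmul y z) f u) /=; ring.
Qed.
End RightAction.

Theorem corollary2 (k : fieldType) (L : postLieType k) (U : postAssType k)
    (iota : {linear L -> U^(-)}) :
  is_universal_enveloping iota -> injective iota.
Proof.
move=> [_ univ] x y eq_xy; apply/eqP.
rewrite -subr_eq0; apply/negP => /negP neq0.
have [f [f_lin f_swap]] := separating_functional (@sub_adjacent_alternating k L)
  (@sub_adjacent_jacobi k L) neq0.
have [psi [_ psiE _]] := univ _ _ (embedding_hom L).
(* The value at [[:: x - y]] is read off at the empty word, and it vanishes because [embedding]
   factors through [iota]. *)
case/eqP; rewrite -[f _]/(embedding (x - y)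
  (make_functional f_lin f_swap) [::]).
by rewrite -psiE linearB eq_xy subrr linear0.
Qed.
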